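(* Let $\lambda_0>0$, $-\frac12\le r\le 1$, and let $k\in\mathbb{R}$ satisfy $k^2=1+r-2r^2$. Consider the initial data $$S^0=\begin{pmatrix}-(r+1)\lambda_0&0&0\\0&r\lambda_0&0\\0&0&\lambda_0\end{pmatrix},\qquad \omega^0=\begin{pmatrix}0\\2k\lambda_0\\0\end{pmatrix}.$$ Let $\lambda$ solve $\partial_t\lambda=r\lambda^2$ with $\lambda(0)=\lambda_0$. Then the pair $(S,\omega)$ given by $$S(t)=\begin{pmatrix}-(r+1)\lambda(t)&0&0\\0&r\lambda(t)&0\\0&0&\lambda(t)\end{pmatrix},\qquad \omega(t)=\begin{pmatrix}0\\2k\lambda(t)\\0\end{pmatrix}$$ is a solution of the strain-vorticity pair equation with initial data $(S^0,\omega^0)$. The general form of this solution is given by $$\lambda(t)=\frac{\lambda_0}{1-r\lambda_0t}.$$ When $r>0$, this solution blows up in finite time, $T_{max}=\frac1{r\lambda_0}$. When $r=0$, this is a stationary solution, and hence $T_{max}=+\infty$. When $r<0$, $T_{max}=+\infty$ and this solution decays at infinity proportionally to $\frac1t$.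
   Context: Strain-vorticity pair equation: for $S\in C^1([0,T_{max});\mathcal{S}^{3\times3})$ (symmetric real $3\times 3$ matrices) with $\operatorname{tr}(S)=0$ and $\omega\in C^1([0,T_{max});\mathbb{R}^3)$, $$\partial_t S+S^2-\tfrac13|S|^2I_3+\tfrac14\omega\otimes\omega-\tfrac1{12}|\omega|^2I_3=0,\qquad \partial_t\omega-S\omega=0,$$ where $|S|^2=\sum_{i,j}S_{ij}^2$ and $(\omega\otimes\omega)_{ij}=\omega_i\omega_j$. $T_{max}$ denotes the maximal time of existence of the solution. *)

(* Defs.v *)
From HB Require Import structures.
From mathcomp Require Import all_boot all_order all_algebra.
From mathcomp Require Import all_classical all_reals all_analysis.

Set Implicit Arguments.
Unset Strict Implicit.
Unset Printing Implicit Defensive.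
Import Order.TTheory GRing.Theory Num.Theory.
Import numFieldNormedType.Exports.
Local Open Scope classical_set_scope.
Local Open Scope ring_scope.

Definition time_interval (R : realType) (T : \bar R) : set R :=
  [set t | 0 <= t /\ (t%:E < T)%E].

(* Derivative relative to [A]: only the values of [f] on [A] matter, so for
   [A = [0, T[] it is the two-sided derivative at [t > 0] and the right
   derivative at [t = 0]. *)
Definition is_derive_within (R : realType) (V : normedModType R)
    (A : set R) (f : R -> V) (t : R) (l : V) : Prop :=
  ((s - t)^-1 *: (f s - f t)) @[s --> within A t^'] --> l.

Definition is_C1_within (R : realType) (V : normedModType R)
    (A : set R) (f df : R -> V) : Prop :=
  (forall t, A t -> is_derive_within A f t (df t)) /\
  {within A, continuous df}.

(* The squared Euclidean (Frobenius) norm; the library norm `|A| on matrices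
   is the sup norm. *)
Definition sqnorm (R : realType) (m n : nat) (A : 'M[R]_(m, n)) : R :=
  \sum_(i < m) \sum_(j < n) A i j ^+ 2.

Definition outer (R : realType) (n : nat) (u v : 'cV[R]_n) : 'M[R]_n :=
  \matrix_(i < n, j < n) (u i 0 * v j 0).

Definition sv_solution (R : realType) (T : \bar R)
    (S : R -> 'M[R]_3) (w : R -> 'cV[R]_3) : Prop :=
  exists (dS : R -> 'M[R]_3) (dw : R -> 'cV[R]_3),
    [/\ is_C1_within (time_interval T) S dS,
        is_C1_within (time_interval T) w dw &
        forall t, time_interval T t ->
          [/\ (S t)^T = S t,
              \tr (S t) = 0,
              dS t + S t *m S t - (3^-1 * sqnorm (S t)) *: 1%:M
                + 4^-1 *: outer (w t) (w t)
                - (12^-1 * sqnorm (w t)) *: 1%:M = 0 &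
              dw t - S t *m w t = 0]].

Definition sv_ivp_solution (R : realType) (T : \bar R)
    (S0 : 'M[R]_3) (w0 : 'cV[R]_3)
    (S : R -> 'M[R]_3) (w : R -> 'cV[R]_3) : Prop :=
  [/\ sv_solution T S w, S 0 = S0 & w 0 = w0].

(* Every solution from the data competes, so this is an upper bound for the
   lifespan of any of them, not only for extensions of a given one. *)
Definition Tmax (R : realType) (S0 : 'M[R]_3) (w0 : 'cV[R]_3) : \bar R :=
  ereal_sup [set T | exists S w, sv_ivp_solution T S0 w0 S w].

Definition strain (R : realType) (r l : R) : 'M[R]_3 :=
  diag_mx (\row_(i < 3) [:: - (r + 1) * l; r * l; l]`_i).

Definition vorticity (R : realType) (k l : R) : 'cV[R]_3 :=
  \col_(i < 3) [:: 0; 2 * k * l; 0]`_i.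

Definition lambda_solution (R : realType) (T : \bar R) (r lambda0 : R)
    (lambda : R -> R) : Prop :=
  (forall t, time_interval T t ->
     @is_derive_within R R^o (time_interval T) lambda t (r * lambda t ^+ 2)) /\
  lambda 0 = lambda0.

Definition blows_up_at (R : realType) (T : R)
    (S : R -> 'M[R]_3) (w : R -> 'cV[R]_3) : Prop :=
  Num.sqrt (sqnorm (S t) + sqnorm (w t)) @[t --> T^'-] --> +oo.

(* (S, w)(t) = (A, v) / t + o(1/t) with a nonzero pair (A, v); the vorticity
   alone may vanish identically. *)
Definition decays_like_inverse_time (R : realType)
    (S : R -> 'M[R]_3) (w : R -> 'cV[R]_3) : Prop :=
  exists (A : 'M[R]_3) (v : 'cV[R]_3),
    [/\ (A, v) <> (0, 0),
        t *: S t @[t --> +oo] --> A &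
        t *: w t @[t --> +oo] --> v].

(* Main.v *)
Require Import Defs.
From HB Require Import structures.
From mathcomp Require Import all_boot all_order all_algebra.
From mathcomp Require Import all_classical all_reals all_analysis.
From mathcomp Require Import ring lra.
Set Implicit Arguments.
Unset Strict Implicit.
Unset Printing Implicit Defensive.
Import Order.TTheory GRing.Theory Num.Theory.
Import numFieldNormedType.Exports.
Local Open Scope classical_set_scope.
Local Open Scope ring_scope.

(** Write [c = r * lambda0].  On the ray of pairs
    [l *: (strain r 1, vorticity k 1)] the quadratic vector field of the
    strain-vorticity equation is again proportional to
    [(strain r 1, vorticity k 1)], with factor [r * l ^+ 2]: this is exactly
    what [k ^+ 2 = 1 + r - 2 * r ^+ 2] buys ([strain_vorticity_algebra]).
    Hence a solution of [lambda' = r * lambda ^+ 2] gives a solution of the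
    system ([lambda_solution_sv]).  The scalar equation is solved by observing
    that [x = lambda * (1 - c * t) - lambda0] satisfies the linear equation
    [x' = r * lambda * x] with [x 0 = 0], so that [x] vanishes
    ([lambda_solution_mul]); as [lambda0] is not zero, this also shows that
    [1 - c * t] has no zero on the interval of existence.

    The lifespan is a supremum over all solutions with the given data.  For
    [r <= 0] the explicit solution lives on the whole half-line, so the
    supremum is infinite.  For [0 < r] a competitor defined beyond [c^-1] has to be
    excluded ([Tmax_le]).  It coincides with the explicit solution before
    [c^-1] by uniqueness ([sv_solution_unique]), where its last diagonal entry
    [lambda0 / (1 - c * t)] is unbounded; but that entry is continuous on the
    segment from [0] to [c^-1], hence bounded.

    Both uniqueness statements reduce to [linear_system_eq0], a Gronwall
    argument for the sum of the squares of finitely many functions.  For the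
    system these are the twelve coordinates of the difference of two solutions.
    As the vector field is polynomial in the coordinates and solutions are
    bounded on segments, the derivative of each difference is bounded by a
    multiple of the sum of all differences; this is obtained from the stability
    of [bounded_close] under sums and products rather than by expanding the
    equation. *)

(** * Derivatives relative to a set *)

(** [f s] is recovered from the difference quotient as
    [(s - t) *: quotient + f t], and the first term tends to zero. *)
Lemma is_derive_within_continuous (R : realType) (V : normedModType R)
    (A : set R) (f : R -> V) (t : R) (l : V) :
  is_derive_within A f t l -> f @ within A (nbhs t) --> f t.
Proof.
move=> fl.
have tA : s @[s --> within A t^'] --> t.
  by move=> P Pt; apply: cvg_within; apply: nbhs_dnbhs Pt.
have cf : (s - t) *: ((s - t)^-1 *: (f s - f t)) + f t
    @[s --> within A t^'] --> (0 : R) *: l + f t.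
  apply: cvgD; last exact: cvg_cst.
  apply: cvgZ fl.
  by rewrite -(subrr t); apply: cvgB; last exact: cvg_cst.
rewrite scale0r add0r in cf.
apply/cvgrPdist_lt => e e0.
move/cvgrPdist_lt : cf => /(_ e e0).
rewrite !near_withinE.
apply: filterS => s H As.
have [->|st] := eqVneq s t; first by rewrite subrr normr0.
have := H st As.
by rewrite scalerA divff ?subr_eq0// scale1r subrK.
Qed.

Lemma within_derivable_continuous (R : realType) (V : normedModType R)
    (A : set R) (f df : R -> V) :
  (forall t, A t -> is_derive_within A f t (df t)) -> {within A, continuous f}.
Proof.
move=> fd; apply/subspace_continuousP => t At.
exact: is_derive_within_continuous (fd t At).
Qed.

Lemma is_derive_within_coord (R : realType) (m n : nat) (A : set R)
    (f : R -> 'M[R]_(m, n)) (t : R) (l : 'M[R]_(m, n)) i j :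
  is_derive_within A f t l ->
  @is_derive_within R R^o A (fun s => f s i j) t (l i j).
Proof.
move=> fl; rewrite /is_derive_within.
have := cvg_comp _ _ fl (@coord_continuous R m n i j l).
by apply: cvg_trans; apply: near_eq_cvg; near=> s; rewrite /= !mxE.
Unshelve. all: by end_near. Qed.

Lemma is_derive_withinZ (R : realType) (V : normedModType R) (A : set R)
    (f : R -> R) (v : V) (t l : R) :
  @is_derive_within R R^o A f t l ->
  is_derive_within A (fun s => f s *: v) t (l *: v).
Proof.
move=> fl; rewrite /is_derive_within.
have H := cvgZ (s := fun x => (x - t)^-1 * (f x - f t)) fl (cvg_cst v).
suff -> : (fun s => (s - t)^-1 *: (f s *: v - f t *: v)) =
    (fun s => ((s - t)^-1 * (f s - f t)) *: v) by exact: H.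
by apply/funext => s; rewrite -scalerBl scalerA.
Qed.

Lemma is_derive_withinB (R : realType) (V : normedModType R) (A : set R)
    (f g : R -> V) (t : R) (l k : V) :
  is_derive_within A f t l -> is_derive_within A g t k ->
  is_derive_within A (fun s => f s - g s) t (l - k).
Proof.
move=> fl gk; rewrite /is_derive_within.
suff -> : (fun s => (s - t)^-1 *: (f s - g s - (f t - g t))) =
    (fun s => (s - t)^-1 *: (f s - f t) - (s - t)^-1 *: (g s - g t)).
  exact: cvgB.
by apply/funext => s; rewrite -scalerBr !opprB addrACA [- g s + _]addrC addrACA.
Qed.

Lemma is_derive_withinM (R : realType) (A : set R) (f g : R -> R) (t l k : R) :
  @is_derive_within R R^o A f t l -> @is_derive_within R R^o A g t k ->
  @is_derive_within R R^o A (fun s => f s * g s) t (l * g t + f t * k).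
Proof.
move=> fl gk; rewrite /is_derive_within.
have gt : g s @[s --> within A t^'] --> g t.
  move=> P /(is_derive_within_continuous gk) [e e0 eP].
  by exists e => // s se st As; exact: eP.
suff -> : (fun s => (s - t)^-1 *: (f s * g s - f t * g t : R^o)) =
    (fun s => (s - t)^-1 * (f s - f t) * g s + f t * ((s - t)^-1 * (g s - g t))).
  by apply: cvgD; apply: cvgM => //; exact: cvg_cst.
by apply/funext => s; rewrite /GRing.scale/=; ring.
Qed.

Lemma near_dnbhs_shift (R : realType) (t : R) (P : set R) :
  (\forall h \near 0^', P (h + t)) <-> (\forall s \near t^', P s).
Proof.
rewrite !near_withinE; split=> [H|/(@nbhs0P R R^o)].
  apply/(@nbhs0P R R^o); apply: filterS H => h.
  by rewrite [t + h]addrC -[_ == t]subr_eq0 addrK.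
by apply: filterS => h; rewrite [t + h]addrC -[_ == t]subr_eq0 addrK.
Qed.

(** Passes from increments [h] tending to [0], as in [derivable], to base
    points [s] tending to [t], as in [is_derive_within]. *)
Lemma is_derive_slopeP (R : realType) (f : R -> R) (t l : R) :
  is_derive t 1 f l <-> (s - t)^-1 * (f s - f t) @[s --> t^'] --> l.
Proof.
have E : ((s - t)^-1 * (f s - f t) @[s --> t^'] --> l) <->
    (h^-1 *: ((f \o shift t) (h *: (1 : R)) - f t) @[h --> 0^'] --> (l : R^o)).
  split=> H; apply/cvgrPdist_lt => e e0.
    move/cvgrPdist_lt : H => /(_ e e0) /near_dnbhs_shift.
    by apply: filterS => h; rewrite addrK /shift /= [h *: _]mulr1.
  move/cvgrPdist_lt : H => /(_ e e0) H; apply/near_dnbhs_shift.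
  by move: H; apply: filterS => h; rewrite addrK /shift /= [h *: _]mulr1.
rewrite E; split=> [[df <-]|H]; first exact: df.
by split; [apply/cvg_ex; exists l|exact: cvg_lim H].
Qed.

Lemma is_derive_within_interior (R : realType) (A : set R) (f : R -> R) (t l : R) :
  nbhs t A -> @is_derive_within R R^o A f t l -> is_derive t 1 f l.
Proof.
move=> At fl; apply/is_derive_slopeP; apply: cvg_trans fl.
move=> P HP.
have At' : t^' A by apply: nbhs_dnbhs.
have {}HP : t^' [set s | A s -> P ((s - t)^-1 * (f s - f t))] := HP.
by apply: filterS2 At' HP => s As; apply.
Qed.

Lemma is_derive_is_derive_within (R : realType) (A : set R) (f : R -> R) (t l : R) :
  is_derive t 1 f l -> @is_derive_within R R^o A f t l.
Proof.
move=> /is_derive_slopeP fl; rewrite /is_derive_within.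
by move=> P Pl; apply: (@cvg_within _ t^'); exact: fl.
Qed.

(** * Gronwall's inequality for finite systems *)

Lemma is_derive_sum_sqr (R : realType) (I : Type) (x : I -> R -> R) (dx : I -> R)
    (t : R) (s : seq I) :
  (forall i, is_derive t 1 (x i) (dx i)) ->
  is_derive t 1 (fun u => \sum_(i <- s) x i u ^+ 2)
    (\sum_(i <- s) 2 * (x i t * dx i)).
Proof.
move=> xd; elim: s => [|i s IHs].
  rewrite big_nil; under eq_fun do rewrite big_nil.
  exact: is_derive_cst.
rewrite big_cons; under eq_fun do rewrite big_cons.
apply: is_deriveD.
have -> : (fun u => x i u ^+ 2) = x i * x i by apply/funext => u; rewrite expr2.
apply: is_derive_eq.
by rewrite /GRing.scale/= mulr_natl mulr2n.
Qed.

(** The function [E t * expR (- c * t)] has a nonpositive derivative, hence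
    is nonincreasing. *)
Lemma gronwall_le0 (R : realType) (E dE : R -> R) (b c : R) :
  0 <= b -> {within `[0, b], continuous E} ->
  (forall t : R, 0 < t < b -> is_derive t 1 E (dE t)) ->
  (forall t : R, 0 < t < b -> dE t <= c * E t) ->
  E 0 <= 0 -> E b <= 0.
Proof.
move=> b0 cE Ed dEle E0.
pose e (t : R) : R := expR (- c * t).
have ed (t : R) : is_derive t 1 e (- c * e t).
  have ld : is_derive t 1 (fun u : R => - c * u) (- c).
    have := is_deriveZ (- c) (is_derive_id t (1 : R)).
    by rewrite /GRing.scale/= mulr1.
  have := @is_derive1_comp R expR _ t _ _ (is_derive_expR _) ld.
  by rewrite /e [X in _ -> is_derive _ _ _ X]mulrC.
have Fd (t : R) : 0 < t < b ->
    is_derive t 1 (E * e) (E t *: (- c * e t) + e t *: dE t).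
  by move=> tb; have ? := Ed t tb; apply: is_deriveM.
have cF : {within `[0, b], continuous (E * e)}.
  move=> t; apply: cvgM; first exact: cE.
  apply: continuous_subspaceT => u.
  by apply: differentiable_continuous; apply/derivable1_diffP; case: (ed u).
have : (E * e) b <= (E * e) 0.
  apply: (ler0_derive1_le_cc _ _ cF); rewrite ?in_itv/= ?lexx ?b0//.
    by move=> t; rewrite in_itv/= => tb; case: (Fd t tb).
  move=> t; rewrite in_itv/= => tb; rewrite derive1E.
  have [_ ->] := Fd t tb.
  have -> : E t *: (- c * e t) + e t *: dE t = (dE t - c * E t) * e t.
    by rewrite /GRing.scale/=; ring.
  by rewrite mulr_le0_ge0 ?expR_ge0// subr_le0 dEle.
rewrite !mulrfctE /e mulr0 expR0 mulr1 => /le_trans/(_ E0).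
by rewrite pmulr_lle0 ?expR_gt0.
Qed.

(** Gronwall applied to the energy [E t = \sum_i x i t ^+ 2]: bounding
    [2 * `|x i t| * `|x j t|] by [x i t ^+ 2 + x j t ^+ 2] in
    [E' = 2 * \sum_i x i * dx i] gives [E' <= 2 * #|I| * `|M| * E].  A
    linear system with bounded coefficients enters through the bound that it
    imposes on the derivatives. *)
Lemma linear_system_eq0 (R : realType) (I : finType) (A : set R)
    (x dx : I -> R -> R) (b M : R) :
  0 <= b -> (forall t : R, 0 <= t <= b -> A t) ->
  (forall i t, A t -> @is_derive_within R R^o A (x i) t (dx i t)) ->
  (forall i (t : R), 0 <= t <= b -> `|dx i t| <= M * \sum_j `|x j t|) ->
  (forall i, x i 0 = 0) ->
  forall i, x i b = 0.
Proof.
move=> b0 bA xd dxle x0.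
have xc i : {within `[0, b], continuous (x i)}.
  apply: (@continuous_subspaceW _ _ _ A).
    by move=> t /=; rewrite in_itv/=; exact: bA.
  exact: (@within_derivable_continuous R R^o _ _ _ (xd i)).
pose E (t : R) : R := \sum_i x i t ^+ 2.
have Ec : {within `[0, b], continuous E}.
  have sqc i : {within `[0, b], continuous (fun u => x i u ^+ 2)}.
    have -> : (fun u => x i u ^+ 2) = x i * x i by apply/funext => u; rewrite expr2.
    by move=> t; apply: cvgM; exact: xc.
  move=> t; apply: cvg_big => [|i _]; first exact: add_continuous.
  exact: sqc.
have Ed (t : R) : 0 < t < b -> is_derive t 1 E (\sum_i 2 * (x i t * dx i t)).
  move=> /andP[t0 tb]; apply: is_derive_sum_sqr => i.
  have tA : nbhs t A.
    apply: (@filterS _ _ _ `]0, b[%classic).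
      by move=> s /=; rewrite in_itv/= => /andP[s0 sb]; apply: bA; rewrite !ltW.
    by apply: open_nbhs_nbhs; split; [exact: itv_open|rewrite /= in_itv/= t0].
  apply: (is_derive_within_interior tA); apply: xd.
  by apply: bA; rewrite !ltW.
have dEle (t : R) : 0 < t < b ->
    \sum_i 2 * (x i t * dx i t) <= (2 * #|I|%:R * `|M|) * E t.
  move=> /andP[t0 tb].
  have H i : 2 * (x i t * dx i t) <= \sum_j `|M| * (x i t ^+ 2 + x j t ^+ 2).
    have itb : 0 <= t <= b by rewrite !ltW.
    apply: (@le_trans _ _ (2 * (`|x i t| * (`|M| * \sum_j `|x j t|)))).
      rewrite ler_pM2l// (le_trans (ler_norm _))// normrM ler_wpM2l//.
      by rewrite (le_trans (dxle _ _ itb))// ler_wpM2r ?ler_norm// sumr_ge0.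
    rewrite !mulr_sumr; apply: ler_sum => j _.
    rewrite -(real_normK (num_real (x i t))) -(real_normK (num_real (x j t))).
    have := mulr_ge0 (normr_ge0 M) (sqr_ge0 (`|x i t| - `|x j t|)).
    by rewrite -subr_ge0; set y := _ * _; congr (0 <= _); rewrite /y; ring.
  apply: (le_trans (ler_sum _ (fun i _ => H i))).
  (* Summing the bound over both indices produces [2 * #|I|] copies of [E t]. *)
  rewrite le_eqVlt; apply/orP; left; apply/eqP.
  under eq_bigr do rewrite -mulr_sumr big_split/= sumr_const -/(E t) -mulr_natl.
  rewrite -mulr_sumr big_split/= sumr_const -mulr_sumr -/(E t) -mulr_natl.
  ring.
have Eb : E b <= 0.
  apply: (gronwall_le0 b0 Ec Ed dEle).
  by rewrite /E big1// => i _; rewrite x0 expr0n.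
have {}Eb : E b = 0.
  by apply/le_anti; rewrite Eb sumr_ge0// => j _; exact: sqr_ge0.
move=> i; apply/eqP; rewrite -sqrf_eq0; apply/eqP.
by apply: (psumr_eq0P _ Eb) => // j _; exact: sqr_ge0.
Qed.

(** * Lipschitz estimates for polynomial expressions *)

(** The pairs of functions that are bounded on [A] and whose distance there is
    controlled by [N].  The three bounds are kept together, with one constant,
    because the distance between two products involves the sizes of the
    factors.  When [N] measures the distance between two curves, this expresses
    that a polynomial expression is Lipschitz along them. *)
Definition bounded_close (R : realType) (A : set R) (N f g : R -> R) : Prop :=
  exists M, forall t, A t ->
    [/\ `|f t| <= M, `|g t| <= M & `|f t - g t| <= M * N t].

Lemma bounded_close_cst (R : realType) (A : set R) (N : R -> R) (c : R) :
  (forall t, 0 <= N t) -> bounded_close A N (fun=> c) (fun=> c).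
Proof.
by move=> N0; exists `|c| => t _; split => //; rewrite subrr normr0 mulr_ge0.
Qed.

Lemma bounded_closeD (R : realType) (A : set R) (N f1 g1 f2 g2 : R -> R) :
  bounded_close A N f1 g1 -> bounded_close A N f2 g2 ->
  bounded_close A N (fun t => f1 t + f2 t) (fun t => g1 t + g2 t).
Proof.
move=> [M1 H1] [M2 H2]; exists (M1 + M2) => t At.
have [a1 b1 c1] := H1 t At; have [a2 b2 c2] := H2 t At.
split; [exact: le_trans (ler_normD _ _) (lerD a1 a2)
       |exact: le_trans (ler_normD _ _) (lerD b1 b2)|].
by rewrite opprD addrACA mulrDl (le_trans (ler_normD _ _))// lerD.
Qed.

(** From [f1 f2 - g1 g2 = f1 (f2 - g2) + g2 (f1 - g1)]. *)
Lemma bounded_closeM (R : realType) (A : set R) (N f1 g1 f2 g2 : R -> R) :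
  (forall t, 0 <= N t) ->
  bounded_close A N f1 g1 -> bounded_close A N f2 g2 ->
  bounded_close A N (fun t => f1 t * f2 t) (fun t => g1 t * g2 t).
Proof.
move=> N0 [M1 H1] [M2 H2]; exists (2 * (M1 * M2)) => t At.
have [a1 b1 c1] := H1 t At; have [a2 b2 c2] := H2 t At.
have M1_ge0 : 0 <= M1 := le_trans (normr_ge0 _) a1.
have M2_ge0 : 0 <= M2 := le_trans (normr_ge0 _) a2.
have MM : M1 * M2 <= 2 * (M1 * M2) by rewrite ler_peMl ?mulr_ge0// ler1n.
split.
- by apply: le_trans MM; rewrite normrM ler_pM.
- by apply: le_trans MM; rewrite normrM ler_pM.
have -> : f1 t * f2 t - g1 t * g2 t =
    f1 t * (f2 t - g2 t) + g2 t * (f1 t - g1 t) by ring.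
apply: le_trans (ler_normD _ _) _; rewrite !normrM.
have -> : 2 * (M1 * M2) * N t = M1 * (M2 * N t) + M2 * (M1 * N t) by ring.
by apply: lerD; apply: ler_pM.
Qed.

Lemma bounded_close_sum (R : realType) (I : Type) (s : seq I) (A : set R)
    (N : R -> R) (f g : I -> R -> R) :
  (forall t, 0 <= N t) -> (forall i, bounded_close A N (f i) (g i)) ->
  bounded_close A N (fun t => \sum_(i <- s) f i t) (fun t => \sum_(i <- s) g i t).
Proof.
move=> N0 fg; elim: s => [|i s IHs].
  under [X in bounded_close _ _ X _]eq_fun do rewrite big_nil.
  under [X in bounded_close _ _ _ X]eq_fun do rewrite big_nil.
  exact: bounded_close_cst.
under [X in bounded_close _ _ X _]eq_fun do rewrite big_cons.
under [X in bounded_close _ _ _ X]eq_fun do rewrite big_cons.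
exact: bounded_closeD.
Qed.

Lemma bounded_close_sqnorm (R : realType) (m n : nat) (A : set R) (N : R -> R)
    (F G : R -> 'M[R]_(m, n)) :
  (forall t, 0 <= N t) ->
  (forall i j, bounded_close A N (fun t => F t i j) (fun t => G t i j)) ->
  bounded_close A N (fun t => sqnorm (F t)) (fun t => sqnorm (G t)).
Proof.
move=> N0 FG; rewrite /sqnorm.
apply: (bounded_close_sum _ N0) => i; apply: (bounded_close_sum _ N0) => j.
under [X in bounded_close _ _ X _]eq_fun do rewrite expr2.
under [X in bounded_close _ _ _ X]eq_fun do rewrite expr2.
exact: bounded_closeM.
Qed.

(** * Uniqueness for the strain-vorticity equation *)

Lemma continuous_itv_bounded (R : realType) (f : R -> R) (b : R) :
  0 <= b -> {within `[0, b], continuous f} ->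
  exists M, forall t, 0 <= t <= b -> `|f t| <= M.
Proof.
move=> b0 cf.
have [M [_ HM]] :=
  compact_bounded (continuous_compact cf (@segment_compact _ 0 b)).
exists (M + 1) => t tb; apply: (HM (M + 1)); first by rewrite ltrDl.
by exists t => //=; rewrite in_itv.
Qed.

Lemma time_interval_itv (R : realType) (T : \bar R) (b t : R) :
  time_interval T b -> 0 <= t <= b -> time_interval T t.
Proof.
by move=> [_ bT] /andP[t0 tb]; split=> //; apply: le_lt_trans bT; rewrite lee_fin.
Qed.

(** The value that the equation prescribes for the time derivative of the
    strain, written entrywise with sums and products only, so that the closure
    properties of [bounded_close] apply. *)
Definition velocity_strain (R : realType) (S : 'M[R]_3) (w : 'cV[R]_3) : 'M[R]_3 :=
  \matrix_(i, j) (- (\sum_k S i k * S k j)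
    + (3^-1 * sqnorm S + 12^-1 * sqnorm w) * (i == j)%:R
    + (- 4^-1) * (w i 0 * w j 0)).

Lemma sv_solution_strainE (R : realType) (S dS : 'M[R]_3) (w : 'cV[R]_3) :
  dS + S *m S - (3^-1 * sqnorm S) *: 1%:M + 4^-1 *: outer w w
    - (12^-1 * sqnorm w) *: 1%:M = 0 -> dS = velocity_strain S w.
Proof.
move=> /matrixP H; apply/matrixP => i j; have := H i j; rewrite !mxE.
move=> H0; apply/eqP; rewrite -subr_eq0 -[X in _ == X]H0; apply/eqP; ring.
Qed.

(** The coordinates of the difference form a system to which
    [linear_system_eq0] applies on every segment from [0] to [b]. *)
Lemma sv_solution_unique (R : realType) (T : \bar R)
    (S S' : R -> 'M[R]_3) (w w' : R -> 'cV[R]_3) :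
  sv_solution T S w -> sv_solution T S' w' -> S 0 = S' 0 -> w 0 = w' 0 ->
  forall t, time_interval T t -> S t = S' t /\ w t = w' t.
Proof.
move=> [dS [dw [[Sd _] [wd _] eqn]]] [dS' [dw' [[Sd' _] [wd' _] eqn']]].
move=> S0 w0 b Tb; have b0 : 0 <= b by case: Tb.
(* Nine entries of the strain and three of the vorticity. *)
pose I : finType := (('I_3 * 'I_3) + 'I_3)%type.
pose pick (S : R -> 'M[R]_3) (w : R -> 'cV[R]_3) (i : I) (t : R) : R :=
  match i with inl p => S t p.1 p.2 | inr k => w t k 0 end.
pose x i t := pick S w i t - pick S' w' i t.
pose dx i t := pick dS dw i t - pick dS' dw' i t.
pose N t := \sum_i `|x i t|.
have N0 t : 0 <= N t by apply: sumr_ge0.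
have itvT t : 0 <= t <= b -> time_interval T t := time_interval_itv Tb.
have pd (S1 dS1 : R -> 'M[R]_3) (w1 dw1 : R -> 'cV[R]_3) :
    (forall t, time_interval T t ->
       is_derive_within (time_interval T) S1 t (dS1 t)) ->
    (forall t, time_interval T t ->
       is_derive_within (time_interval T) w1 t (dw1 t)) ->
    forall i t, time_interval T t -> @is_derive_within R R^o (time_interval T)
      (pick S1 w1 i) t (pick dS1 dw1 i t).
  move=> Sd1 wd1 [[i j]|i] t Tt.
    exact: is_derive_within_coord (Sd1 t Tt).
  exact: is_derive_within_coord (wd1 t Tt).
have bc i : bounded_close [set t | 0 <= t <= b] N (pick S w i) (pick S' w' i).
  have cont (S1 dS1 : R -> 'M[R]_3) (w1 dw1 : R -> 'cV[R]_3)
        (Sd1 : forall t, time_interval T t ->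
         is_derive_within (time_interval T) S1 t (dS1 t))
        (wd1 : forall t, time_interval T t ->
         is_derive_within (time_interval T) w1 t (dw1 t)) :
    {within `[0, b], continuous (pick S1 w1 i)}.
    apply: (@continuous_subspaceW _ _ _ (time_interval T)).
      by move=> t /=; rewrite in_itv/=; exact: itvT.
    apply: (@within_derivable_continuous R R^o _ _ (pick dS1 dw1 i)).
    exact: (pd _ _ _ _ Sd1 wd1 i).
  have [M1 HM1] := continuous_itv_bounded b0 (cont _ _ _ _ Sd wd).
  have [M2 HM2] := continuous_itv_bounded b0 (cont _ _ _ _ Sd' wd').
  (* The summand [1] makes the constant at least [1], as the distance between
     two coordinates is at most [N] itself. *)
  exists (`|M1| + `|M2| + 1) => t tb; split.
  - by have := HM1 t tb; have := ler_norm M1; have := normr_ge0 M2; lra.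
  - by have := HM2 t tb; have := ler_norm M2; have := normr_ge0 M1; lra.
  have : `|x i t| <= N t.
    by rewrite /N (bigD1 i)//= lerDl sumr_ge0.
  move=> /le_trans; apply; rewrite ler_peMl//.
  by have := normr_ge0 M2; have := normr_ge0 M1; lra.
have bcS i j :
    bounded_close [set t | 0 <= t <= b] N (fun t => S t i j) (fun t => S' t i j).
  exact: bc (inl (i, j)).
have bcw i (j : 'I_1) :
    bounded_close [set t | 0 <= t <= b] N (fun t => w t i j) (fun t => w' t i j).
  by rewrite (ord1 j); exact: bc (inr i).
have [M HM] : exists M, forall i t, 0 <= t <= b -> `|dx i t| <= M * N t.
  have bcd i : exists M, forall t, 0 <= t <= b -> `|dx i t| <= M * N t.
    case: i => [[i j]|i].
      have : bounded_close [set t | 0 <= t <= b] N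
          (fun t => velocity_strain (S t) (w t) i j)
          (fun t => velocity_strain (S' t) (w' t) i j).
        under [X in bounded_close _ _ X _]eq_fun do rewrite mxE -mulN1r.
        under [X in bounded_close _ _ _ X]eq_fun do rewrite mxE -mulN1r.
        repeat first [exact: bcS|exact: bcw|exact: bounded_close_cst
          |apply: bounded_closeD|apply: (bounded_closeM N0)
          |apply: (bounded_close_sqnorm N0) => ? ?
          |apply: (bounded_close_sum _ N0) => ?].
      move=> [M HM]; exists M => t tb; have [_ _] := HM t tb.
      have [_ _ /sv_solution_strainE <- _] := eqn t (itvT t tb).
      by have [_ _ /sv_solution_strainE <- _] := eqn' t (itvT t tb).
    have : bounded_close [set t | 0 <= t <= b] N
        (fun t => (S t *m w t) i 0) (fun t => (S' t *m w' t) i 0).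
      under [X in bounded_close _ _ X _]eq_fun do rewrite mxE.
      under [X in bounded_close _ _ _ X]eq_fun do rewrite mxE.
      by apply: (bounded_close_sum _ N0) => k; apply: (bounded_closeM N0).
    move=> [M HM]; exists M => t tb; have [_ _] := HM t tb.
    have [_ _ _ /subr0_eq <-] := eqn t (itvT t tb).
    by have [_ _ _ /subr0_eq <-] := eqn' t (itvT t tb).
  (* One constant for all coordinates. *)
  have [f Hf] := choice bcd.
  exists (\sum_i `|f i|) => i t tb; apply: (le_trans (Hf i t tb)).
  rewrite ler_wpM2r// (le_trans (ler_norm _))//.
  by rewrite (bigD1 i)//= lerDl sumr_ge0.
have xb : forall i, x i b = 0.
  apply: (linear_system_eq0 b0 itvT _ HM) => [i t Tt|[[i j]|i]].
  - exact: is_derive_withinB (pd _ _ _ _ Sd wd i t Tt) (pd _ _ _ _ Sd' wd' i t Tt).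
  - by rewrite /x/= S0 subrr.
  - by rewrite /x/= w0 subrr.
split; apply/matrixP => i j; apply/eqP; rewrite -subr_eq0; apply/eqP.
  exact: xb (inl (i, j)).
by rewrite (ord1 j); exact: xb (inr i).
Qed.

Lemma sv_solution_restrict (R : realType) (T T' : \bar R)
    (S : R -> 'M[R]_3) (w : R -> 'cV[R]_3) :
  (T' <= T)%E -> sv_solution T S w -> sv_solution T' S w.
Proof.
move=> TT [dS [dw [C1S C1w eqn]]].
have sub : time_interval T' `<=` time_interval T.
  by move=> t [t0 tT]; split=> //; exact: lt_le_trans TT.
have C1 (V : normedModType R) (f df : R -> V) :
    is_C1_within (time_interval T) f df -> is_C1_within (time_interval T') f df.
  move=> [fd cdf]; split; last exact: continuous_subspaceW sub cdf.
  move=> t Tt P /(fd t (sub t Tt)) [e e0 eP].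
  by exists e => // s se st /sub; exact: eP.
exists dS, dw; split; [exact: C1|exact: C1|].
by move=> t /sub; exact: eqn.
Qed.

(** * The scalar equation *)

Lemma is_derive_affine (R : realType) (c t : R) :
  is_derive t 1 (fun s : R => 1 - c * s) (- c).
Proof.
have := is_deriveB (is_derive_cst (1 : R) t (1 : R))
  (is_deriveZ c (is_derive_id t (1 : R))).
by rewrite /GRing.scale/= mulr1 sub0r.
Qed.

(** The defect [lambda * (1 - r * lambda0 * t) - lambda0] solves a linear
    equation with zero initial value.  Clearing the denominator makes this
    argument work before one knows that [1 - r * lambda0 * t] does not vanish,
    and in particular across its possible zero. *)
Lemma lambda_solution_mul (R : realType) (T : \bar R) (r lambda0 : R)
    (lambda : R -> R) :
  lambda_solution T r lambda0 lambda ->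
  forall t, time_interval T t -> lambda t * (1 - r * lambda0 * t) = lambda0.
Proof.
move=> [ld l0] b Tb; have b0 : 0 <= b by case: Tb.
have itvT t : 0 <= t <= b -> time_interval T t := time_interval_itv Tb.
have cl : {within `[0, b], continuous lambda}.
  apply: (@continuous_subspaceW _ _ _ (time_interval T)).
    by move=> t /=; rewrite in_itv/=; exact: itvT.
  exact: (@within_derivable_continuous R R^o _ _ _ ld).
have [M HM] := continuous_itv_bounded b0 cl.
pose x (_ : 'I_1) t := lambda t * (1 - r * lambda0 * t) - lambda0.
pose dx i t := r * lambda t * x i t.
apply: subr0_eq; rewrite -/(x ord0 b).
apply: (@linear_system_eq0 _ _ _ x dx b (`|r| * M) b0 itvT) => [i t Tt|i t tb|i].
- have dd : @is_derive_within R R^o (time_interval T)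
      (fun s => 1 - r * lambda0 * s) t (- (r * lambda0)).
    exact/is_derive_is_derive_within/is_derive_affine.
  have d0 : @is_derive_within R R^o (time_interval T) (fun=> lambda0) t 0.
    by apply: is_derive_is_derive_within; exact: is_derive_cst.
  have -> : dx i t = r * lambda t ^+ 2 * (1 - r * lambda0 * t)
      + lambda t * - (r * lambda0) - 0 by rewrite /dx /x; ring.
  exact: is_derive_withinB (is_derive_withinM (ld t Tt) dd) d0.
- rewrite big_ord1 /dx (ord1 i) !normrM -!mulrA ler_wpM2l//.
  by rewrite ler_wpM2r// HM.
- by rewrite /x l0; ring.
Qed.

Lemma lambda_solution_explicit (R : realType) (T : \bar R) (r lambda0 : R) :
  (forall t, time_interval T t -> 1 - r * lambda0 * t != 0) ->
  lambda_solution T r lambda0 (fun t => lambda0 / (1 - r * lambda0 * t)).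
Proof.
move=> H; split; last by rewrite mulr0 subr0 divr1.
move=> t /H d0; apply: is_derive_is_derive_within.
have dd := is_derive_affine (r * lambda0) t.
have -> : r * (lambda0 / (1 - r * lambda0 * t)) ^+ 2 =
    lambda0 * (- (1 - r * lambda0 * t) ^- 2 * - (r * lambda0)) by field.
have := is_deriveZ lambda0 (@is_deriveV R (fun s => 1 - r * lambda0 * s) t _ 1 d0 dd).
by [].
Qed.

Lemma lambda_denominator_gt0 (R : realType) (r lambda0 t : R) :
  0 < lambda0 -> 0 <= t -> (0 < r -> t < (r * lambda0)^-1) ->
  0 < 1 - r * lambda0 * t.
Proof.
move=> l0 t0 tr; have [r0|r0] := ltP 0 r.
  rewrite subr_gt0 -(@mulfV _ (r * lambda0)) ?gt_eqF ?mulr_gt0//.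
  by rewrite ltr_pM2l ?mulr_gt0// tr.
rewrite (@lt_le_trans _ _ 1)// lerDl oppr_ge0.
by rewrite mulr_le0_ge0// mulr_le0_ge0// ltW.
Qed.

Lemma lambda_blowup (R : realType) (r lambda0 : R) :
  0 < r -> 0 < lambda0 ->
  lambda0 / (1 - r * lambda0 * t) @[t --> (r * lambda0)^-1^'-] --> +oo.
Proof.
move=> r0 l0; have c0 : 0 < r * lambda0 by rewrite mulr_gt0.
have cN : r * lambda0 != 0 by rewrite gt_eqF.
pose d (t : R) := (1 - r * lambda0 * t) / lambda0.
have -> : (fun t => lambda0 / (1 - r * lambda0 * t)) = (fun t => (d t)^-1).
  by apply/funext => t; rewrite /d invf_div.
apply/cvgrVy.
  near=> t; rewrite /d divr_gt0// subr_gt0 -(mulfV cN) ltr_pM2l//.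
have -> : 0 = d (r * lambda0)^-1 by rewrite /d mulfV// subrr mul0r.
apply: cvg_at_left_filter; rewrite /d.
apply: cvgM; last exact: cvg_cst.
apply: cvgB; first exact: cvg_cst.
by apply: cvgM; [exact: cvg_cst|exact: cvg_id].
Unshelve. all: by end_near. Qed.

(** [t * lambda t = - r^-1 + r^-1 / (1 - r * lambda0 * t)], and the
    denominator tends to infinity since [r < 0]. *)
Lemma lambda_decay (R : realType) (r lambda0 : R) :
  r < 0 -> 0 < lambda0 ->
  t * (lambda0 / (1 - r * lambda0 * t)) @[t --> +oo] --> - r^-1.
Proof.
move=> r0 l0; have c0 : 0 < - (r * lambda0) by rewrite oppr_gt0 nmulr_rlt0.
pose d (t : R) := 1 + - (r * lambda0) * t.
have d_gt0 : \forall t \near +oo, 0 < d t.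
  near=> t; rewrite /d addr_gt0// mulr_gt0//.
have dV : (d t)^-1 @[t --> +oo] --> 0.
  apply/(gtr0_cvgV0 d_gt0); apply/cvgryPge => B; near=> t.
  rewrite /d -lerBlDl mulrC -ler_pdivrMr//.
have H : - r^-1 + r^-1 * (d t)^-1 @[t --> +oo] --> - r^-1 + r^-1 * 0.
  by apply: cvgD; [exact: cvg_cst|apply: cvgM; [exact: cvg_cst|exact: dV]].
rewrite mulr0 addr0 in H.
apply: cvg_trans H; apply: near_eq_cvg; near=> t.
have : 0 < d t by near: t.
rewrite /d mulNr => /lt0r_neq0 dN.
by field; rewrite dN lt_eqF.
Unshelve. all: by end_near. Qed.

(** * The self-similar solution and its lifespan *)

Lemma strainZ (R : realType) (r l : R) : strain r l = l *: strain r 1.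
Proof.
apply/matrixP => i j; rewrite !mxE mulrnAr; congr (_ *+ _).
by case: i => [[|[|[|//]]]] ? /=; ring.
Qed.

Lemma vorticityZ (R : realType) (k l : R) : vorticity k l = l *: vorticity k 1.
Proof.
apply/matrixP => i j; rewrite !mxE.
by case: i => [[|[|[|//]]]] ? /=; ring.
Qed.

Lemma strain_corner (R : realType) (r l : R) : strain r l ord_max ord_max = l.
Proof. by rewrite !mxE. Qed.

Lemma normr_entry_le_sqrt_sqnorm (R : realType) (m n : nat) (A : 'M[R]_(m, n)) i j :
  `|A i j| <= Num.sqrt (sqnorm A).
Proof.
rewrite -sqrtr_sqr ler_wsqrtr// /sqnorm (bigD1 i)//= (bigD1 j)//= -addrA lerDl.
rewrite addr_ge0// ?sumr_ge0// => k _; rewrite ?sqr_ge0// sumr_ge0// => l _.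
exact: sqr_ge0.
Qed.

(** Along the ansatz the spatial equations become identities in [r] and [l],
    once [k ^+ 2] is replaced.  The relation on [k] enters through the
    vorticity terms of the diagonal entries of the strain equation. *)
Lemma strain_vorticity_algebra (R : realType) (r k l : R) :
  k ^+ 2 = 1 + r - 2 * r ^+ 2 ->
  [/\ (strain r l)^T = strain r l, \tr (strain r l) = 0,
      strain r (r * l ^+ 2) + strain r l *m strain r l
        - (3^-1 * sqnorm (strain r l)) *: 1%:M
        + 4^-1 *: outer (vorticity k l) (vorticity k l)
        - (12^-1 * sqnorm (vorticity k l)) *: 1%:M = 0 &
      vorticity k (r * l ^+ 2) - strain r l *m vorticity k l = 0].
Proof.
move=> k2; split.
- exact: tr_diag_mx.
- by rewrite mxtrace_diag !big_ord_recl big_ord0 !mxE /=; ring.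
- have k2' : (2 * k * l) * (2 * k * l) = 4 * (1 + r - 2 * r ^+ 2) * l ^+ 2.
    by rewrite -k2; ring.
  apply/matrixP => i j; rewrite /sqnorm !mxE !big_ord_recl !big_ord0 !mxE.
  by case: i => [[|[|[|//]]]] ?; case: j => [[|[|[|//]]]] ?;
    rewrite /= ?expr2 ?k2' ?mulr1n ?mulr0n; field.
- apply/matrixP => i j; rewrite !mxE !big_ord_recl !big_ord0 !mxE.
  by case: i => [[|[|[|//]]]] ? /=; rewrite ?mulr1n ?mulr0n; ring.
Qed.

(** Both fields are the scalar function [lambda] times a constant matrix, so
    their regularity is that of [lambda]. *)
Lemma lambda_solution_sv (R : realType) (T : \bar R) (r k lambda0 : R)
    (lambda : R -> R) :
  k ^+ 2 = 1 + r - 2 * r ^+ 2 -> lambda_solution T r lambda0 lambda ->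
  sv_ivp_solution T (strain r lambda0) (vorticity k lambda0)
    (fun t => strain r (lambda t)) (fun t => vorticity k (lambda t)).
Proof.
move=> k2 [ld l0]; split; rewrite ?l0//.
have cl := @within_derivable_continuous R R^o _ _ _ ld.
have C1 (V : normedModType R) (v : V) : is_C1_within (time_interval T)
    (fun t => lambda t *: v) (fun t => (r * lambda t ^+ 2) *: v).
  split=> [t Tt|]; first exact: is_derive_withinZ (ld t Tt).
  move=> t; apply: cvgZ; last exact: cvg_cst.
  apply: cvgM; first exact: cvg_cst.
  have -> : (fun u => lambda u ^+ 2) = lambda * lambda.
    by apply/funext => u; rewrite expr2.
  by apply: cvgM; exact: cl.
exists (fun t => strain r (r * lambda t ^+ 2)).
exists (fun t => vorticity k (r * lambda t ^+ 2)); split.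
- under [X in is_C1_within _ X _]eq_fun do rewrite strainZ.
  under [X in is_C1_within _ _ X]eq_fun do rewrite strainZ.
  exact: C1.
- under [X in is_C1_within _ X _]eq_fun do rewrite vorticityZ.
  under [X in is_C1_within _ _ X]eq_fun do rewrite vorticityZ.
  exact: C1.
- by move=> t _; exact: strain_vorticity_algebra.
Qed.

(** A solution living past [(r * lambda0)^-1] would have a corner entry that is
    bounded up to that time by continuity, and unbounded by uniqueness. *)
Lemma Tmax_le (R : realType) (r k lambda0 : R) :
  0 < r -> 0 < lambda0 -> k ^+ 2 = 1 + r - 2 * r ^+ 2 ->
  (Tmax (strain r lambda0) (vorticity k lambda0) <= ((r * lambda0)^-1)%:E)%E.
Proof.
move=> r0 l0 k2; apply: ge_ereal_sup => T [S [w [sol S0 w0]]].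
set T0 := (r * lambda0)^-1; rewrite leNgt; apply/negP => T0T.
have T0_gt0 : 0 < T0 by rewrite invr_gt0 mulr_gt0.
pose lambda (t : R) := lambda0 / (1 - r * lambda0 * t).
have TT : time_interval T T0 by split=> //; exact: ltW.
have eS t : 0 <= t -> t < T0 -> S t ord_max ord_max = lambda t.
  move=> t0 tT0.
  have lsol : lambda_solution T0%:E r lambda0 lambda.
    apply: lambda_solution_explicit => s [s0]; rewrite lte_fin => sT0.
    by rewrite gt_eqF// lambda_denominator_gt0.
  have [sol' S0' w0'] := lambda_solution_sv k2 lsol.
  have [] := sv_solution_unique (sv_solution_restrict (ltW T0T) sol) sol' _ _
    (_ : time_interval T0%:E t).
  - by rewrite S0 S0'.
  - by rewrite w0 w0'.
  - by split=> //; rewrite lte_fin.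
  - by move=> -> _; exact: strain_corner.
have [M HM] : exists M, forall t, 0 <= t <= T0 -> `|S t ord_max ord_max| <= M.
  apply: continuous_itv_bounded; first exact: ltW.
  apply: (@continuous_subspaceW _ _ _ (time_interval T)).
    by move=> t /=; rewrite in_itv/=; exact: time_interval_itv.
  have [dS [dw [[Sd _] _ _]]] := sol.
  apply: (@within_derivable_continuous R R^o _ _ (fun t => dS t ord_max ord_max)).
  by move=> t Tt; exact: is_derive_within_coord (Sd t Tt).
have /cvgry_gt /(_ M) := lambda_blowup r0 l0.
rewrite -/T0 => large.
have [t [tT0 t0 ML]] : exists t, [/\ t < T0, 0 <= t & M < lambda t].
  near T0^'- => t; exists t; split => //; near: t => //.
  by apply: nbhs_left_ge.
have := HM t; rewrite eS// t0 ltW// => /(_ isT).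
by rewrite leNgt (lt_le_trans ML)// ler_norm.
Unshelve. all: by end_near. Qed.

Theorem theorem2p1 (R : realType) (lambda0 r k : R)
    (lambda0_gt0 : 0 < lambda0) (r_ge : - 2^-1 <= r) (r_le : r <= 1)
    (k_sqr : k ^+ 2 = 1 + r - 2 * r ^+ 2) :
  let S0 := strain r lambda0 in
  let w0 := vorticity k lambda0 in
  (forall (T : \bar R) (lambda : R -> R),
     lambda_solution T r lambda0 lambda ->
     sv_ivp_solution T S0 w0
       (fun t => strain r (lambda t)) (fun t => vorticity k (lambda t)) /\
     (forall t, time_interval T t ->
        1 - r * lambda0 * t != 0 /\
        lambda t = lambda0 / (1 - r * lambda0 * t))) /\
  (let lambda := fun t : R => lambda0 / (1 - r * lambda0 * t) in
   let S := fun t : R => strain r (lambda t) in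
   let w := fun t : R => vorticity k (lambda t) in
   [/\ lambda_solution (Tmax S0 w0) r lambda0 lambda,
       sv_ivp_solution (Tmax S0 w0) S0 w0 S w,
       0 < r ->
         Tmax S0 w0 = ((r * lambda0)^-1)%:E /\ blows_up_at (r * lambda0)^-1 S w,
       r = 0 ->
         (forall t, 0 <= t -> S t = S0 /\ w t = w0) /\ Tmax S0 w0 = +oo%E &
       r < 0 ->
         Tmax S0 w0 = +oo%E /\ decays_like_inverse_time S w]).
Proof.
move=> S0 w0; split=> [T lambda sol|lambda S w].
  split=> [|t Tt]; first exact: lambda_solution_sv.
  have lE := lambda_solution_mul sol Tt.
  have dN : 1 - r * lambda0 * t != 0.
    apply/eqP => d0; move: lE lambda0_gt0; rewrite d0 mulr0 => <-.
    by rewrite ltxx.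
  by split=> //; apply: (mulIf dN); rewrite lE divfK.
have explicit T : (0 < r -> (T <= ((r * lambda0)^-1)%:E)%E) ->
    lambda_solution T r lambda0 lambda.
  move=> HT; apply: lambda_solution_explicit => t [t0 tT].
  rewrite gt_eqF// lambda_denominator_gt0// => r0.
  by rewrite -lte_fin (lt_le_trans tT)// HT.
have Tmax_ge T : (0 < r -> (T <= ((r * lambda0)^-1)%:E)%E) -> (T <= Tmax S0 w0)%E.
  move=> /explicit HT; apply: ereal_sup_ubound.
  by exists S, w; exact: lambda_solution_sv.
have Tmax_y : r <= 0 -> Tmax S0 w0 = +oo%E.
  by move=> r0; apply/eqP; rewrite -leye_eq Tmax_ge// ltNge r0.
have solT : lambda_solution (Tmax S0 w0) r lambda0 lambda.
  by apply: explicit => r0; exact: Tmax_le.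
split=> //; first exact: lambda_solution_sv.
- move=> r0; split.
    by apply/eqP; rewrite eq_le Tmax_le// Tmax_ge.
  apply/cvgryPge => B; have /cvgry_ge /(_ B) := lambda_blowup r0 lambda0_gt0.
  apply: filterS => t /le_trans; apply.
  rewrite -/(lambda t) -[leLHS](strain_corner r) (le_trans (ler_norm _))//.
  rewrite (le_trans (normr_entry_le_sqrt_sqnorm _ _ _))// ler_wsqrtr// lerDl.
  by apply: sumr_ge0 => i _; apply: sumr_ge0 => j _; exact: sqr_ge0.
- move=> r0; split; last by apply: Tmax_y; rewrite r0.
  by move=> t _; rewrite /S /w /lambda r0 !mul0r subr0 divr1 -r0.
- move=> r0; split; first by apply: Tmax_y; exact: ltW.
  have tl := lambda_decay r0 lambda0_gt0.
  exists (- r^-1 *: strain r 1), (- r^-1 *: vorticity k 1); split.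
  + move=> [/matrixP/(_ ord_max ord_max) + _].
    by rewrite !mxE /= mulr1n mulr1 => /eqP; rewrite oppr_eq0 invr_eq0 lt_eqF.
  + have -> : (fun t => t *: S t) = (fun t => (t * lambda t) *: strain r 1).
      by apply/funext => t; rewrite /S strainZ scalerA.
    by apply: cvgZ tl _; exact: cvg_cst.
  + have -> : (fun t => t *: w t) = (fun t => (t * lambda t) *: vorticity k 1).
      by apply/funext => t; rewrite /w vorticityZ scalerA.
    by apply: cvgZ tl _; exact: cvg_cst.
Qed.
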